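(* Let $\mathfrak l$ be an abelian Lie algebra and $(\mathfrak a,[\cdot,\cdot]_{\mathfrak a},\omega_{\mathfrak a})$ a symplectic Lie algebra. Let $\gamma:\mathfrak l\to\operatorname{Hom}(\mathfrak a,\mathfrak l^* )$ and $\xi:\mathfrak l\to\operatorname{Hom}(\mathfrak a,\mathfrak a)$ be linear maps and let $\epsilon:\mathfrak l\times\mathfrak l\to\mathfrak l^*$ be an alternating bilinear map. Then $\mathfrak d_{\gamma,\epsilon,\xi}(\mathfrak l,\mathfrak a)=(\mathfrak l^*\oplus\mathfrak a\oplus\mathfrak l,[\cdot,\cdot],\omega)$ is a symplectic Lie algebra if and only if $(\gamma,\epsilon,\xi)\in Z^2(\mathfrak l,\mathfrak a,\omega_{\mathfrak a})$.
   Context: All vector spaces and Lie algebras are real and finite-dimensional. A symplectic Lie algebra $(\mathfrak g,\omega)$ is a Lie algebra $\mathfrak g$ with a skew-symmetric non-degenerate bilinear form $\omega$ such that $\omega([X,Y],Z)+\omega([Y,Z],X)+\omega([Z,X],Y)=0$ for all $X,Y,Z$. Given a triple $(\gamma,\epsilon,\xi)$ as in the claim, write $\gamma(L_1,A,L_2):=(\gamma(L_1)(A))(L_2)$. Define the alternating bilinear maps $\alpha:\mathfrak l\times\mathfrak l\to\mathfrak a$ and $\beta:\mathfrak a\times\mathfrak a\to\mathfrak l^*$ by $$\omega_{\mathfrak a}(\alpha(L_1,L_2),A)=\gamma(L_1,A,L_2)-\gamma(L_2,A,L_1),\qquad \beta(A_1,A_2)(L)=-\omega_{\mathfrak a}(\xi(L)A_1,A_2)-\omega_{\mathfrak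 a}(A_1,\xi(L)A_2).$$ On $\mathfrak l^*\oplus\mathfrak a\oplus\mathfrak l$ define the skew-symmetric bilinear map $[\cdot,\cdot]$ by $[\mathfrak l^*,\mathfrak l^*\oplus\mathfrak a\oplus\mathfrak l]=0$, $[A_1,A_2]=\beta(A_1,A_2)+[A_1,A_2]_{\mathfrak a}$, $[L,A]=\gamma(L)A+\xi(L)A$, $[L_1,L_2]=\epsilon(L_1,L_2)+\alpha(L_1,L_2)$, and the skew-symmetric form $\omega(Z_1+A_1+L_1,Z_2+A_2+L_2)=Z_1(L_2)+\omega_{\mathfrak a}(A_1,A_2)-Z_2(L_1)$, for $Z_i\in\mathfrak l^*$, $A,A_i\in\mathfrak a$, $L,L_i\in\mathfrak l$. $Z^2(\mathfrak l,\mathfrak a,\omega_{\mathfrak a})$ is the set of triples $(\gamma,\epsilon,\xi)$ such that for all $L,L_i\in\mathfrak l$, $A,A_i\in\mathfrak a$: (1) every $\xi(L)$ is a derivation of $\mathfrak a$, $\xi(L_1)\xi(L_2)-\xi(L_2)\xi(L_1)=\operatorname{ad}_{\mathfrak a}(\alpha(L_1,L_2))$, and $\xi(L_1)\alpha(L_2,L_3)+\xi(L_2)\alpha(L_3,L_1)+\xi(L_3)\alpha(L_1,L_2)=0$; (2) $\beta(\xi(L)A_1,A_2)+\beta(A_1,\xi(L)A_2)=\gamma(L)[A_1,A_2]_{\mathfrak a}$; (3) $\gamma(L_2)(\xi(L_1)A)-\gamma(L_1)(\xi(L_2)A)+\beta(\alpha(L_1,L_2),A)=0$; (4) $\gamma(L_1)\alpha(L_2,L_3)+\gamma(L_2)\alpha(L_3,L_1)+\gamma(L_3)\alpha(L_1,L_2)=0$;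 (5) $\epsilon(L_1,L_2)L_3+\epsilon(L_2,L_3)L_1+\epsilon(L_3,L_1)L_2=0$. *)

(* Defs.v *)
From HB Require Import structures.
From mathcomp Require Import all_boot all_order all_algebra.
From mathcomp Require Import reals.

Set Implicit Arguments.
Unset Strict Implicit.
Unset Printing Implicit Defensive.

Import GRing.Theory.

Local Open Scope ring_scope.

(** Finite-dimensional real vector spaces are objects of [vectType R] with
    [R : realType]. Brackets and forms are plain functions, so that being a Lie
    bracket or a symplectic form is a property that can hold or fail. *)

Section LieAlgebras.
Variables (R : realType) (V : vectType R).

Definition is_bilinear (U W : vectType R) (f : V -> U -> W) : Prop :=
  bilinear_for *:%R *:%R f.

Definition alternating (W : vectType R) (f : V -> V -> W) : Prop :=
  forall x, f x x = 0.

Definition jacobi (br : V -> V -> V) : Prop :=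
  forall x y z, br x (br y z) + br y (br z x) + br z (br x y) = 0.

Definition is_lie_algebra (br : V -> V -> V) : Prop :=
  [/\ is_bilinear br, alternating br & jacobi br].

Definition abelian_lie (br : V -> V -> V) : Prop := forall x y, br x y = 0.

Definition is_derivation (br : V -> V -> V) (D : 'End(V)) : Prop :=
  forall x y, D (br x y) = br (D x) y + br x (D y).

Definition skew_symmetric (om : V -> V -> R^o) : Prop :=
  forall x y, om x y = - om y x.

Definition nondegenerate_form (om : V -> V -> R^o) : Prop :=
  forall x, (forall y, om x y = 0) -> x = 0.

Definition closed_form (br : V -> V -> V) (om : V -> V -> R^o) : Prop :=
  forall x y z, om (br x y) z + om (br y z) x + om (br z x) y = 0.

Definition is_symplectic_form (br : V -> V -> V) (om : V -> V -> R^o) : Prop :=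
  [/\ is_bilinear om, skew_symmetric om, nondegenerate_form om
    & closed_form br om].

Definition is_symplectic_lie_algebra (br : V -> V -> V) (om : V -> V -> R^o)
  : Prop := is_lie_algebra br /\ is_symplectic_form br om.

End LieAlgebras.

Definition dual (R : realType) (V : vectType R) : vectType R := 'Hom(V, R^o).

Section Extension.
Variables (R : realType) (l a : vectType R).
Variables (bra : a -> a -> a) (oma : a -> a -> R^o).
Variables (gamma : 'Hom(l, 'Hom(a, dual l))) (eps : l -> l -> dual l).
Variable xi : 'Hom(l, 'End(a)).

(** [linfun f] is the linear map that agrees with [f] when [f] is linear. *)
Definition flat : 'Hom(a, dual a) :=
  linfun (fun A : a => linfun (oma A) : dual a).

(** [gamma L1 A L2] is the value of gamma(L1)(A) in l^* at [L2]. The map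
    [alpha] is obtained from its defining equation (lemma [alphaP]) by inverting
    [flat], which is bijective for a nondegenerate bilinear form. *)
Definition alpha (L1 L2 : l) : a :=
  (flat^-1)%VF (linfun (fun A : a => gamma L1 A L2 - gamma L2 A L1 : R^o)).

Definition beta (A1 A2 : a) : dual l :=
  linfun (fun L : l => - oma (xi L A1) A2 - oma A1 (xi L A2) : R^o).

Definition ext : vectType R := (dual l * a * l)%type.

(** Skew-symmetric bilinear extension of the prescribed values, for
    [x = (Z1, A1, L1)] and [y = (Z2, A2, L2)]. *)
Definition ext_bracket (x y : ext) : ext :=
  let: (_, A1, L1) := x in
  let: (_, A2, L2) := y in
  (beta A1 A2 + gamma L1 A2 - gamma L2 A1 + eps L1 L2,
   bra A1 A2 + xi L1 A2 - xi L2 A1 + alpha L1 L2,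
   0).

Definition ext_form (x y : ext) : R^o :=
  let: (Z1, A1, L1) := x in
  let: (Z2, A2, L2) := y in
  Z1 L2 + oma A1 A2 - Z2 L1.

Record Z2 : Prop := MkZ2 {
  Z2_derivation : forall L, is_derivation bra (xi L);
  Z2_xi_comm : forall L1 L2 A,
    xi L1 (xi L2 A) - xi L2 (xi L1 A) = bra (alpha L1 L2) A;
  Z2_xi_alpha : forall L1 L2 L3,
    xi L1 (alpha L2 L3) + xi L2 (alpha L3 L1) + xi L3 (alpha L1 L2) = 0;
  Z2_beta_xi : forall L A1 A2,
    beta (xi L A1) A2 + beta A1 (xi L A2) = gamma L (bra A1 A2);
  Z2_gamma_xi : forall L1 L2 A,
    gamma L2 (xi L1 A) - gamma L1 (xi L2 A) + beta (alpha L1 L2) A = 0;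
  Z2_gamma_alpha : forall L1 L2 L3,
    gamma L1 (alpha L2 L3) + gamma L2 (alpha L3 L1) + gamma L3 (alpha L1 L2) = 0;
  Z2_eps : forall L1 L2 L3,
    eps L1 L2 L3 + eps L2 L3 L1 + eps L3 L1 L2 = 0
}.

Hypothesis oma_bil : is_bilinear oma.

Lemma flatE A B : flat A B = oma A B.
Proof.
have linr (C : a) : linear (oma C : a -> R^o) by exact: oma_bil.2.
have flE C D : (linfun (oma C) : dual a) D = oma C D.
  pose g : {linear a -> R^o} := HB.pack (oma C)
    (GRing.isLinear.Build R a R^o *:%R (oma C) (linr C)).
  exact: (lfunE g).
have linl : linear (fun C : a => linfun (oma C) : dual a).
  move=> k C D; apply/lfunP => E.
  by rewrite flE add_lfunE scale_lfunE !flE; apply: oma_bil.1.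
pose g : {linear a -> dual a} := HB.pack (fun C : a => linfun (oma C) : dual a)
  (GRing.isLinear.Build R a (dual a) *:%R _ linl).
by rewrite /flat (lfunE g) /= flE.
Qed.

Lemma alphaP : nondegenerate_form oma -> forall L1 L2 A,
  oma (alpha L1 L2) A = gamma L1 A L2 - gamma L2 A L1.
Proof.
move=> nd L1 L2 A.
have ker0 : lker flat == 0%VS.
  rewrite -subv0; apply/subvP => x; rewrite memv_ker memv0 => /eqP fx0.
  by apply/eqP/nd => y; rewrite -flatE fx0 zero_lfunE.
have full : limg flat = fullv.
  apply/eqP; rewrite eqEdim subvf limg_dim_eq ?(eqP ker0) ?capv0 //.
  by rewrite !dimvf /dim /= muln1.
rewrite -flatE /alpha limg_lfunVK ?full ?memvf //.
pose h (B : a) : R^o := gamma L1 B L2 - gamma L2 B L1.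
have linh : linear h.
  by move=> k B C; rewrite /h !linearP !add_lfunE !scale_lfunE scalerBr opprD addrACA.
pose g : {linear a -> R^o} := HB.pack h (GRing.isLinear.Build R a R^o *:%R h linh).
exact: (lfunE g).
Qed.

Lemma betaE A1 A2 L :
  beta A1 A2 L = - oma (xi L A1) A2 - oma A1 (xi L A2).
Proof.
pose h (M : l) : R^o := - oma (xi M A1) A2 - oma A1 (xi M A2).
have linh : linear h.
  move=> k M N; rewrite /h !linearP !add_lfunE !scale_lfunE.
  have -> := oma_bil.1 A2 k (xi M A1) (xi N A1).
  have -> := oma_bil.2 A1 k (xi M A2) (xi N A2).
  by rewrite scalerBr scalerN !opprD addrACA.
pose g : {linear l -> R^o} := HB.pack h (GRing.isLinear.Build R l R^o *:%R h linh).
exact: (lfunE g).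
Qed.

End Extension.

(* Main.v *)
Require Import Defs.
From HB Require Import structures.
From mathcomp Require Import all_boot all_order all_algebra.
From mathcomp Require Import reals ring lra.

Import GRing.Theory.

Local Open Scope ring_scope.

(** Sorting the Jacobi identity by the types of its arguments in [l] and [a] and
    by the component of its value, conditions (1)-(4) are exactly equations so
    obtained, and condition (5) is closedness of the form on [l x l x l]. Apart
    from the axioms of [a], three equations remain. Closedness on [l x l x a]
    and on [l x a x a] holds by the choice of [alpha] and [beta]. The
    [dual l]-component of the Jacobi identity on [a x a x a] says that [beta] is
    a cocycle; as the [xi L] are derivations, its value at [L] is obtained by
    differentiating the closedness of [oma] along [xi L]. *)

Section Bilinear.
Context {R : realType} {V U W : vectType R} {f : V -> U -> W}.
Hypothesis f_bil : is_bilinear f.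

Lemma bilDl x y z : f (x + y) z = f x z + f y z.
Proof. by have := f_bil.1 z 1 x y; rewrite /= !scale1r. Qed.

Lemma bilDr x y z : f x (y + z) = f x y + f x z.
Proof. by have := f_bil.2 x 1 y z; rewrite /= !scale1r. Qed.

Lemma bil0l z : f 0 z = 0.
Proof. by apply: (addrI (f 0 z)); rewrite -bilDl !addr0. Qed.

Lemma bil0r x : f x 0 = 0.
Proof. by apply: (addrI (f x 0)); rewrite -bilDr !addr0. Qed.

Lemma bilZl k x z : f (k *: x) z = k *: f x z.
Proof. by have := f_bil.1 z k x 0; rewrite /= bil0l !addr0. Qed.

Lemma bilZr k x z : f x (k *: z) = k *: f x z.
Proof. by have := f_bil.2 x k z 0; rewrite /= bil0r !addr0. Qed.

Lemma bilNl x z : f (- x) z = - f x z.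
Proof. by rewrite -scaleN1r bilZl scaleN1r. Qed.

Lemma bilNr x z : f x (- z) = - f x z.
Proof. by rewrite -scaleN1r bilZr scaleN1r. Qed.

End Bilinear.

(** Polarization: the vanishing diagonal value at [x + y] expands into the sum of the two mixed
    terms. *)
Lemma alternating_skew {R : realType} {V W : vectType R} {f : V -> V -> W} :
  is_bilinear f -> alternating f -> forall x y, f x y = - f y x.
Proof.
move=> bil alt x y; apply/eqP; rewrite -addr_eq0; apply/eqP.
have := alt (x + y).
by rewrite (bilDl bil) !(bilDr bil) !alt addr0 add0r.
Qed.

(** The coordinates of [v] in a basis are themselves functionals, so all of them vanish. *)
Lemma dual_separates (R : realType) (V : vectType R) (v : V) :
  (forall Z : dual V, Z v = 0) -> v = 0.
Proof.
move=> v0; rewrite (coord_vbasis (memvf v)) big1 // => i _.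
have /= := v0 (linfun (coord (vbasis fullv) i : V -> R^o)).
by rewrite lfunE /= => ->; rewrite scale0r.
Qed.

(** Turns the scaling of [R^o] into a product of scalars, the form in which [ring] can treat it. *)
Lemma regularZ (R : realType) (k : R) (x : R^o) : k *: x = k * x :> R.
Proof. by []. Qed.

Section Extension.
Context {R : realType} {l a : vectType R}.
Context {bra : a -> a -> a} {oma : a -> a -> R^o}.
Context {gamma : 'Hom(l, 'Hom(a, dual l))} {eps : l -> l -> dual l}.
Context {xi : 'Hom(l, 'End(a))}.
Hypothesis bra_bil : is_bilinear bra.
Hypothesis bra_alt : alternating bra.
Hypothesis bra_jacobi : jacobi bra.
Hypothesis oma_bil : is_bilinear oma.
Hypothesis oma_skew : skew_symmetric oma.
Hypothesis oma_nd : nondegenerate_form oma.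
Hypothesis oma_closed : closed_form bra oma.
Hypothesis eps_bil : is_bilinear eps.
Hypothesis eps_alt : alternating eps.

Local Notation al := (alpha oma gamma).
Local Notation be := (beta oma xi).
Local Notation br := (ext_bracket bra oma gamma eps xi).
Local Notation om := (@ext_form R l a oma).

(** Since [alphaP] describes [alpha] only through its pairings with [oma], identities involving
    [alpha] are tested against an arbitrary [C]; this also reduces vector identities in [a] to
    scalar ones for [ring] and [lra]. *)
Lemma oma_inj x y : (forall C, oma x C = oma y C) -> x = y.
Proof.
move=> e; apply/eqP; rewrite -subr_eq0; apply/eqP/oma_nd => C.
by rewrite (bilDl oma_bil) (bilNl oma_bil) e subrr.
Qed.

Definition lfun_opsE := (@add_lfunE, @opp_lfunE, @scale_lfunE, @zero_lfunE).

Lemma alpha_bilinear : is_bilinear al.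
Proof.
split=> [z k x y|z k x y]; apply: oma_inj => C;
  rewrite (bilDl oma_bil) (bilZl oma_bil) !alphaP //.
- rewrite !linearP !lfun_opsE /= ?regularZ; ring.
- rewrite !linearP !lfun_opsE /= ?regularZ; ring.
Qed.

Lemma alpha_alternating : alternating al.
Proof.
by move=> x; apply: oma_inj => C; rewrite alphaP // subrr (bil0l oma_bil).
Qed.

Lemma beta_bilinear : is_bilinear be.
Proof.
split=> [z k x y|z k x y]; apply/lfunP => C; rewrite !lfun_opsE !betaE //;
  rewrite !linearP;
  rewrite !(bilDl oma_bil, bilDr oma_bil, bilZl oma_bil, bilZr oma_bil)
    /= ?regularZ; ring.
Qed.

Lemma beta_alternating : alternating be.
Proof.
by move=> x; apply/lfunP => C; rewrite betaE // oma_skew opprK subrr lfunE.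
Qed.

Lemma ext_bracket_bilinear : is_bilinear br.
Proof.
have [be_bil al_bil] := (beta_bilinear, alpha_bilinear).
split=> [] [[Z3 A3] L3] k [[Z1 A1] L1] [[Z2 A2] L2].
- congr (_, _, _); rewrite /= ?scaler0 ?addr0 //.
  + apply/lfunP => C.
    rewrite (bilDl be_bil) (bilZl be_bil) (bilDl eps_bil) (bilZl eps_bil).
    rewrite !linearP !lfun_opsE /= ?regularZ; ring.
  + apply: oma_inj => C.
    rewrite (bilDl bra_bil) (bilZl bra_bil) (bilDl al_bil) (bilZl al_bil).
    rewrite !linearP !lfun_opsE.
    rewrite !(bilDl oma_bil, bilNl oma_bil, bilZl oma_bil) /= ?regularZ; ring.
- congr (_, _, _); rewrite /= ?scaler0 ?addr0 //.
  + apply/lfunP => C.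
    rewrite (bilDr be_bil) (bilZr be_bil) (bilDr eps_bil) (bilZr eps_bil).
    rewrite !linearP !lfun_opsE /= ?regularZ; ring.
  + apply: oma_inj => C.
    rewrite (bilDr bra_bil) (bilZr bra_bil) (bilDr al_bil) (bilZr al_bil).
    rewrite !linearP !lfun_opsE.
    rewrite !(bilDl oma_bil, bilNl oma_bil, bilZl oma_bil) /= ?regularZ; ring.
Qed.

Lemma ext_bracket_alternating : alternating br.
Proof.
move=> [[Z A] L].
by rewrite /= beta_alternating alpha_alternating bra_alt eps_alt
  !add0r !addr0 !subrr.
Qed.

Lemma ext_form_bilinear : is_bilinear om.
Proof.
split=> [] [[Z3 A3] L3] k [[Z1 A1] L1] [[Z2 A2] L2];
  rewrite /= ?(bilDl oma_bil, bilZl oma_bil, bilDr oma_bil, bilZr oma_bil)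
    !linearP !lfun_opsE /= ?regularZ; ring.
Qed.

Lemma ext_form_skew : skew_symmetric om.
Proof. by move=> [[Z1 A1] L1] [[Z2 A2] L2]; rewrite /= oma_skew; ring. Qed.

Lemma ext_form_nondegenerate : nondegenerate_form om.
Proof.
move=> [[Z A] L] xn.
(* Each summand tests one component: vectors of [l] detect [Z], vectors of [a] detect [A], and
   functionals on [l] detect [L]. *)
have Z0 : Z = 0.
  apply/lfunP => M; have := xn (0, 0, M).
  by rewrite /= (bil0r oma_bil) !lfun_opsE subr0 addr0.
have A0 : A = 0.
  apply: oma_nd => B; have := xn (0, B, 0).
  by rewrite /= linear0 !lfun_opsE subr0 add0r.
have L0 : L = 0.
  apply: dual_separates => Y; apply/eqP; rewrite -oppr_eq0; apply/eqP.
  have := xn (Y, 0, 0).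
  by rewrite /= linear0 (bil0r oma_bil) !add0r.
by rewrite Z0 A0 L0.
Qed.

Lemma Z2_of_symplectic :
  jacobi br -> closed_form br om -> Z2 bra oma gamma eps xi.
Proof.
move=> jac closed.
have [be_bil al_bil] := (beta_bilinear, alpha_bilinear).
have bil0 := (bil0l be_bil, bil0r be_bil, bil0l al_bil, bil0r al_bil,
  bil0l bra_bil, bil0r bra_bil, bil0l eps_bil, bil0r eps_bil, @linear0,
  bil0l oma_bil, bil0r oma_bil, @zero_lfunE,
  addr0, add0r, subr0, @oppr0).
have bilN := (bilNl be_bil, bilNr be_bil, bilNl bra_bil, bilNr bra_bil,
  @linearN).
(* Only the first two components are kept, as brackets have no [l]-component; destructing the
   equality of pairs gives the [dual l]-equation and the [a]-equation separately. *)
have J x y z := congr1 (fun u : ext l a => (u.1.1, u.1.2)) (jac x y z).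
have be_skew := alternating_skew be_bil beta_alternating.
have bra_skew := alternating_skew bra_bil bra_alt.
split.
- move=> L A B; have [_] := J (0, 0, L) (0, A, 0) (0, B, 0).
  rewrite !bil0 !bilN (bra_skew B) -addrA -opprD => /subr0_eq ->.
  exact: addrC.
- move=> L M A; have [_] := J (0, 0, L) (0, 0, M) (0, A, 0).
  by rewrite !bil0 !bilN (bra_skew A) => /subr0_eq.
- move=> L M N; have [_] := J (0, 0, L) (0, 0, M) (0, 0, N).
  by rewrite !bil0.
- move=> L A B; have [+ _] := J (0, 0, L) (0, A, 0) (0, B, 0).
  rewrite !bil0 !bilN (be_skew B) -addrA -opprD => /subr0_eq ->.
  exact: addrC.
- move=> L M A; have [+ _] := J (0, 0, L) (0, 0, M) (0, A, 0).
  rewrite !bil0 !bilN (be_skew A) => /subr0_eq <-.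
  by rewrite addrA subrK subrr.
- move=> L M N; have [+ _] := J (0, 0, L) (0, 0, M) (0, 0, N).
  by rewrite !bil0.
(* Against a vector of [l] the form sees only the [dual l]-component of a bracket, which is [eps]
   here. *)
- move=> L M N; have := closed (0, 0, L) (0, 0, M) (0, 0, N).
  by rewrite /= !bil0.
Qed.

Lemma beta_cocycle : (forall L, is_derivation bra (xi L)) ->
  forall A1 A2 A3,
  be A1 (bra A2 A3) + be A2 (bra A3 A1) + be A3 (bra A1 A2) = 0.
Proof.
move=> der A1 A2 A3; apply/lfunP => L; rewrite !lfun_opsE !betaE //.
(* Summing the three instances and regrouping by the derivation rule, each [bra Ai Aj] meets [Ak] in
   the two terms of [beta (bra Ai Aj) Ak] at [L], up to sign. *)
have := oma_closed (xi L A1) A2 A3.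
have := oma_closed A1 (xi L A2) A3.
have := oma_closed A1 A2 (xi L A3).
rewrite !der !(bilDr oma_bil).
rewrite !(oma_skew (bra _ _)); lra.
Qed.

Lemma ext_bracket_jacobi : Z2 bra oma gamma eps xi -> jacobi br.
Proof.
move=> [der xic xial bexi gaxi gaal _].
have [be_bil al_bil] := (beta_bilinear, alpha_bilinear).
have be_skew := alternating_skew be_bil beta_alternating.
have bra_skew := alternating_skew bra_bil bra_alt.
have bilN := (bilNl be_bil, bilNr be_bil, bilNl bra_bil, bilNr bra_bil,
  @linearN).
have bilD := (bilDl be_bil, bilDr be_bil, bilDl bra_bil, bilDr bra_bil,
  @linearD).
have omaDN := (bilDl oma_bil, bilNl oma_bil, bil0l oma_bil).
move=> [[Z1 A1] L1] [[Z2 A2] L2] [[Z3 A3] L3].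
congr (_, _, _) => /=; last by rewrite !addr0.
- apply/lfunP => M.
  (* [gaxi] settles the terms with two arguments in [l], [gaal] those with three, and [beta_cocycle]
     those with none. The terms with one argument in [l] are settled by [bexi], read backwards to
     remove [gamma] of a bracket. *)
  have := congr1 (fun Z : dual l => Z M) (gaxi L1 L2 A3).
  have := congr1 (fun Z : dual l => Z M) (gaxi L2 L3 A1).
  have := congr1 (fun Z : dual l => Z M) (gaxi L3 L1 A2).
  have := congr1 (fun Z : dual l => Z M) (gaal L1 L2 L3).
  have := congr1 (fun Z : dual l => Z M) (beta_cocycle der A1 A2 A3).
  rewrite !(bil0r eps_bil) !linear0 !bilD !bilN /= -!bexi.
  rewrite !(be_skew (xi _ _)) !(be_skew (al _ _)) !lfun_opsE; lra.
- apply: oma_inj => C.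
  (* The unmixed terms are cyclic sums left to [lra]; the mixed ones cancel after expanding by [der]
     and replacing brackets with [alpha] by commutators through [xic]. *)
  have := congr1 (oma ^~ C) (xial L1 L2 L3).
  have := congr1 (oma ^~ C) (bra_jacobi A1 A2 A3).
  rewrite /= !(bil0r al_bil) !linear0 !lfun_opsE !bilD !bilN /= !der.
  rewrite !(bra_skew _ (al _ _)) -!xic !(bra_skew (xi _ _)) !omaDN; lra.
Qed.

Lemma ext_form_closed :
  (forall L1 L2 L3, eps L1 L2 L3 + eps L2 L3 L1 + eps L3 L1 L2 = 0) ->
  closed_form br om.
Proof.
move=> eps0 [[Z1 A1] L1] [[Z2 A2] L2] [[Z3 A3] L3].
have := eps0 L1 L2 L3; have := oma_closed A1 A2 A3.
rewrite /= !lfun_opsE !linear0 !(bilDl oma_bil) !(bilNl oma_bil) !alphaP //.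
rewrite !betaE //.
(* With [alpha] and [beta] eliminated, moving every [xi] to the first slot of [oma] lets the mixed
   terms cancel in pairs. *)
rewrite !(oma_skew _ (xi _ _)); lra.
Qed.

End Extension.

Theorem theorem2 (R : realType) (l a : vectType R)
    (brl : l -> l -> l) (bra : a -> a -> a) (oma : a -> a -> R^o)
    (gamma : 'Hom(l, 'Hom(a, dual l))) (eps : l -> l -> dual l)
    (xi : 'Hom(l, 'End(a)))
    (brl_lie : is_lie_algebra brl) (brl_abelian : abelian_lie brl)
    (a_symplectic : is_symplectic_lie_algebra bra oma)
    (eps_bilinear : is_bilinear eps) (eps_alternating : alternating eps) :
  is_symplectic_lie_algebra (ext_bracket bra oma gamma eps xi)
    (@ext_form R l a oma)
  <-> Z2 bra oma gamma eps xi.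
Proof.
have [[bra_bil bra_alt bra_jac] [oma_bil oma_skew oma_nd oma_closed]] :=
  a_symplectic.
split=> [[[_ _ jac] [_ _ _ closed]]|cocycle]; first exact: Z2_of_symplectic.
split; split.
- exact: ext_bracket_bilinear.
- exact: ext_bracket_alternating.
- exact: ext_bracket_jacobi.
- exact: ext_form_bilinear.
- exact: ext_form_skew.
- exact: ext_form_nondegenerate.
- by apply: ext_form_closed => //; apply: Z2_eps cocycle.
Qed.
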